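(* Let $s\ge1$ be an integer, $a\in(0,1]$, $\delta>1$, and let $(h_n)_{n\ge1}$ be positive reals with $h_n\to0$. Let $f$ be a probability density on $\mathbb{R}$ whose derivative $f^{(s)}$ exists and belongs to $L_1$, to $C$, and to $Lip(a,\delta)$. Let $\{K_n\}_{n\ge1}$ be a sequence of kernels of order $s$ on $\mathbb{R}$ such that: (1) $\alpha_s(K_n)=O(h_n^a)$ as $n\to\infty$; (2) $\sup_n\max\{\beta_{s+a}(K_n),\beta_{s+\delta}(K_n)\}<\infty$. Then $$\|f\ast S_{h_n}K_n-f\|_1=O(h_n^{s+a})\quad\text{as } n\to\infty .$$
   Context: All integrals are over $\mathbb{R}$ with respect to Lebesgue measure. $L_1$ is the space of integrable functions on $\mathbb{R}$ with norm $\|g\|_1=\int|g|$, and $C$ is the space of bounded continuous functions on $\mathbb{R}$ with norm $\|g\|_C=\sup|g|$. A kernel is a (measurable, integrable, real-valued, not necessarily nonnegative) function $K$ on $\mathbb{R}$ with $\int K(x)\,dx=1$. For a function $K$, $\alpha_j(K)=\int t^jK(t)\,dt$ (integer $j\ge0$) and $\beta_m(K)=\int|t|^m|K(t)|\,dt$ (real $m\ge0$). A kernel $K$ is of order $s$ if $\alpha_j(K)=0$ for $j=1,\dots,s-1$ and $\alpha_s(K)\neq0$ (with these moments absolutely convergent). For $h>0$, $(S_hK)(x)=\frac1hK\left(\frac xh\right)$. Convolution is $(f\ast g)(x)=\int g(y)f(x-y)\,dy$. For $a\in(0,1]$ and $\delta>1$, $Lip(a,\delta)$ is the set of functions $g:\mathbb{R}\to\mathbb{R}$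 for which there exist positive (measurable) functions $l,r$ on $\mathbb{R}$ such that $$|g(x-h)-g(x)|\le l(x)|h|^a\quad\text{for all }x\in\mathbb{R}\text{ and all }h\text{ with }|h|\le r(x),$$ and $$\int\left(l(x)+r(x)^{-\delta}\right)dx<\infty .$$ *)

(* Defs.v *)
From HB Require Import structures.
From mathcomp Require Import all_boot all_order all_algebra.
From mathcomp Require Import all_classical all_reals all_analysis.
Set Implicit Arguments.
Unset Strict Implicit.
Unset Printing Implicit Defensive.
Import Order.TTheory GRing.Theory Num.Theory.
Import numFieldNormedType.Exports.
Local Open Scope classical_set_scope.
Local Open Scope ring_scope.

Section Definitions.
Context {R : realType}.
Implicit Types (f g K : R -> R) (s j n : nat) (a delta h m : R).

Local Notation mu := (@lebesgue_measure R).

Definition inL1 g : Prop := mu.-integrable setT (EFin \o g).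

(* [fine] sends [+oo] to 0, so this is the L1 norm only when [inL1 g]. *)
Definition normL1 g : R := fine ('N[mu]_1[EFin \o g])%E.

Definition inC g : Prop := continuous g /\ bounded_fun g.

Definition inLip a delta g : Prop :=
  exists l r : R -> R,
    [/\ measurable_fun setT l /\ measurable_fun setT r,
        forall x, 0 < l x /\ 0 < r x,
        forall x h, `|h| <= r x -> `|g (x - h) - g x| <= l x * `|h| `^ a
      & (\int[mu]_x (l x + r x `^ (- delta))%:E < +oo)%E].

Definition is_density f : Prop :=
  [/\ measurable_fun setT f,
      forall x, 0 <= f x
    & (\int[mu]_x (f x)%:E = 1)%E].

(* [derive1n] is total; this says that [derive1n s f] is a genuine derivative
   at every point. *)
Definition times_derivable s f : Prop :=
  forall k x, (k < s)%N -> derivable (derive1n k f) x 1.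

Definition alpha j K : R := (\int[mu]_t (t ^+ j * K t))%R.

Definition beta m K : \bar R := (\int[mu]_t (`|t| `^ m * `|K t|)%:E)%E.

Definition is_kernel K : Prop := inL1 K /\ (\int[mu]_x K x)%R = 1.

Definition kernel_of_order s K : Prop :=
  [/\ is_kernel K,
      forall j, (j <= s)%N -> inL1 (fun t => t ^+ j * K t),
      forall j, (1 <= j < s)%N -> alpha j K = 0
    & alpha s K != 0].

Definition dilate h K : R -> R := fun x => h^-1 * K (x / h).

Definition convolution f g : R -> R := fun x => (\int[mu]_y (g y * f (x - y)))%R.

End Definitions.

(* Main.v *)
Require Import Defs.
From HB Require Import structures.
From mathcomp Require Import all_boot all_order all_algebra.
From mathcomp Require Import all_classical all_reals all_analysis.
From mathcomp Require Import measurable_realfun ring.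
Set Implicit Arguments.
Unset Strict Implicit.
Unset Printing Implicit Defensive.
Import Order.TTheory GRing.Theory Num.Theory.
Import numFieldNormedType.Exports.
Local Open Scope classical_set_scope.
Local Open Scope ring_scope.

(** The proof is a Taylor expansion carried out separately at every point x.

    Put g := f^(s).  Membership in Lip(a, delta) only controls g near x, for
    shifts v with |v| <= r x.  For a larger shift, boundedness of g by M gives
    |g (x + v) - g x| <= 2 M <= 2 M (|v| / r x)^delta.  The two ranges
    are therefore covered by one estimate, valid for all v,
      |g (x + v) - g x| <= A x |v|^a + B x |v|^delta,
    with A = l and B = 2 M r^(- delta) both integrable ([inLip_modulus]).

    Since g is the s-th derivative, the degree s Taylor polynomial T of f at x
    satisfies |f (x + v) - T v| <= (A x |v|^a + B x |v|^delta) |v|^s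
    ([taylor_oscillation]).  After the substitution y = h t, the convolution
    at x is the integral of K t * f (x - h t).  The moments of K of order
    1, .., s - 1 vanish, so integrating T (- h t) against K leaves
    f x + g x / s! (- h)^s alpha_s, and the remainder is at most
      A x h^(s+a) beta_(s+a) + B x h^(s+delta) beta_(s+delta)
    ([convolution_expansion]).

    Integrating this pointwise bound in x gives three contributions: the term
    with alpha_s is O(h^s h^a) because alpha_s = O(h^a), the second is
    O(h^(s+a)), and the third is O(h^(s+delta)), hence O(h^(s+a)) once h <= 1,
    because delta > 1 >= a.  Tonelli shows that the convolution is measurable
    ([measurable_convolution]), so the pointwise bound also makes the error
    integrable. *)

(** * Taylor expansion with the remainder bounded by an oscillation *)

Lemma mean_value_bound (R : realType) (phi dphi : R -> R) (C v : R) :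
  phi 0 = 0 -> (forall u, is_derive u (1 : R) phi (dphi u)) ->
  (forall u, `|u| <= `|v| -> `|dphi u| <= C) -> `|phi v| <= C * `|v|.
Proof.
move=> phi0 dphiP dphiC.
have phi_continuous : continuous phi.
  by move=> u; apply/differentiable_continuous/derivable1_diffP; case: (dphiP u).
have [v_ge0|/ltW v_le0] := leP 0 v.
- have [c cv /eqP] := MVT_segment v_ge0 (fun u _ => dphiP u)
    (continuous_subspaceT phi_continuous).
  rewrite phi0 !subr0 => /eqP ->; rewrite normrM ler_wpM2r// dphiC//.
  by move: cv; rewrite in_itv/= => /andP[c_ge0 cv]; rewrite !ger0_norm.
- have [c cv /eqP] := MVT_segment v_le0 (fun u _ => dphiP u)
    (continuous_subspaceT phi_continuous).
  rewrite phi0 !sub0r mulrN eqr_opp => /eqP ->.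
  rewrite normrM ler_wpM2r// dphiC//.
  by move: cv; rewrite in_itv/= => /andP[cv c_le0]; rewrite !ler0_norm// lerN2.
Qed.

(** The variable stands for the increment from [x]. *)
Definition taylor_poly (R : realType) (s : nat) (f : R -> R) (x : R) :
    {poly R} :=
  \poly_(j < s.+1) (derive1n j f x / j`!%:R).

Lemma deriv_taylor_poly (R : realType) (s : nat) (f : R -> R) (x : R) :
  (taylor_poly s.+1 f x)^`()%R = taylor_poly s (derive1 f) x.
Proof.
apply/polyP => j; rewrite coef_deriv !coef_poly ltnS.
case: ifP => _; last by rewrite mul0rn.
rewrite derive1Sn factS natrM -mulr_natr.
by field; rewrite !pnatr_eq0 -lt0n fact_gt0 addrC natr1 pnatr_eq0.
Qed.

(** Unlike the usual Taylor bound, the last derivative is only compared with its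
    own value at [x], which is what a Lipschitz-type condition controls.  The
    remainder of [f] has for derivative the remainder of [f'] at one order
    less, so the mean value inequality gains one power of [v] at each step of
    the induction; the factor [1 / s!] is lost, as only the rate matters. *)
Lemma taylor_oscillation (R : realType) (s : nat) (f : R -> R) (x V M : R) :
  times_derivable s f ->
  (forall u, `|u| <= V -> `|derive1n s f (x + u) - derive1n s f x| <= M) ->
  forall v, `|v| <= V -> `|f (x + v) - (taylor_poly s f x).[v]| <= M * `|v| ^+ s.
Proof.
elim: s f M => [|s IH] f M df osc v vV.
  rewrite expr0 mulr1 /taylor_poly poly_def big_ord1 expr0 hornerZ hornerC.
  by rewrite mulr1 fact0 divr1 osc.
pose phi u := f (x + u) - (taylor_poly s.+1 f x).[u].
pose dphi u := derive1 f (x + u) - (taylor_poly s (derive1 f) x).[u].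
have -> : f (x + v) - (taylor_poly s.+1 f x).[v] = phi v by [].
rewrite exprSr mulrA; apply: (@mean_value_bound _ phi dphi).
- rewrite /phi addr0 horner_coef0 coef_poly ltn0Sn fact0 divr1.
  by rewrite subrr.
- move=> u; rewrite /phi /dphi -deriv_taylor_poly.
  apply: is_deriveB.
  have := @is_derive1_comp R f (fun u => x + u) u (derive1 f (x + u)) 1.
  rewrite mulr1; apply.
    by apply: DeriveDef; [exact: (df 0%N)|rewrite derive1E].
  by rewrite -[X in is_derive _ _ _ X]add0r; apply: is_deriveD.
- move=> u uv; apply: le_trans (IH _ M _ _ u (le_trans uv vV)) _.
  + by move=> k y ks; rewrite -derive1Sn; exact: df.
  + by move=> w wV; rewrite -!derive1Sn; exact: osc.
  + rewrite ler_wpM2l//; last by rewrite lerXn2r// nnegrE.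
    by apply: le_trans (osc 0 _); rewrite ?normr0 // (le_trans _ vV).
Qed.

(** * Change of variable and measurability for convolutions *)

(** A measure on the line is determined by its values on the intervals ]u, v],
    whose preimages are ]u c, v c]. *)
Lemma lebesgue_measure_dilate (R : realType) (c : R) (A : set R) :
  0 < c -> measurable A ->
  pushforward (@lebesgue_measure R)
    (fun y : measurableTypeR R => y / c : measurableTypeR R) A =
  (c%:E * lebesgue_measure A)%E.
Proof.
move=> c_gt0 mA.
have c1_ge0 : 0 <= c^-1 by rewrite invr_ge0 ltW.
have preE (u v : R) : (fun y => y / c) @^-1` `]u, v] = `]u * c, v * c]%classic.
  by apply/seteqP; split => x /=; rewrite !in_itv/= ltr_pdivlMr// ler_pdivrMr.
have scaleE : lebesgue_measure A = mscale (NngNum c1_ge0)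
    (pushforward (@lebesgue_measure R)
      (fun y : measurableTypeR R => y / c : measurableTypeR R)) A.
  move=> mdiv; apply: lebesgue_measure_unique => // _ [[u v]] _ <-.
  transitivity
    (c^-1%:E * lebesgue_measure ((fun y => (y / c)%R) @^-1` `]u, v]))%E => //.
  rewrite preE !lebesgue_measure_itv/= !lte_fin ltr_pM2r//.
  case: ifP => _; last by rewrite mule0.
  rewrite -EFinD -EFinM; congr EFin.
  by rewrite -mulrBl mulrC mulfK ?gt_eqF.
rewrite (scaleE (mulrr_measurable _)).
by rewrite /mscale/= muleA -EFinM divff ?gt_eqF// mul1e.
Qed.

Lemma ge0_integral_dilate (R : realType) (c : R) (G : R -> \bar R) :
  0 < c -> measurable_fun setT G -> (forall t, 0 <= G t)%E ->
  (\int[lebesgue_measure]_y (c^-1%:E * G (y / c)%R) =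
   \int[lebesgue_measure]_t G t)%E.
Proof.
move=> c_gt0 mG G_ge0.
have mdiv : measurable_fun setT
    (fun y : measurableTypeR R => y / c : measurableTypeR R).
  exact: mulrr_measurable.
rewrite ge0_integralZl//; last 2 first.
- exact: (measurableT_comp mG mdiv).
- by rewrite lee_fin invr_ge0 ltW.
rewrite -[X in (_ * X)%E](@ge0_integral_pushforward _ _ _ _ _ _ mdiv _ setT)//.
rewrite (@eq_measure_integral _ _ _ _
  (mscale (PosNum c_gt0)%:num%:nng lebesgue_measure)); last first.
  by move=> A mA _; rewrite [LHS]lebesgue_measure_dilate.
by rewrite ge0_integral_mscale//= muleA -EFinM mulVf ?gt_eqF// mul1e.
Qed.

(** The substitution is done on positive and negative parts, so the equality
    holds whether or not the integrand is integrable. *)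
Lemma convolution_dilate (R : realType) (f K : R -> R) (c x : R) :
  0 < c -> measurable_fun setT f -> measurable_fun setT K ->
  convolution f (dilate c K) x =
  (\int[lebesgue_measure]_t (K t * f (x - c * t)))%R.
Proof.
move=> c_gt0 mf mK; rewrite /convolution /dilate /Rintegral; congr fine.
pose G t := (K t * f (x - c * t))%:E.
have mG : measurable_fun setT G.
  apply/measurable_EFinP; apply: measurable_funM => //.
  apply: measurableT_comp => //.
  by apply: measurable_funB => //; exact: mulrl_measurable.
transitivity (\int[lebesgue_measure]_y (c^-1%:E * G (y / c)%R))%E.
  apply: eq_integral => y _.
  by rewrite /G -EFinM -mulrA (mulrC c) divfK ?gt_eqF.
rewrite [LHS]integralE [RHS]integralE ge0_funeposM ?invr_ge0 ?ltW//.
rewrite ge0_funenegM ?invr_ge0 ?ltW//.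
rewrite (funepos_comp G) (funeneg_comp G).
by congr (_ - _)%E; apply: ge0_integral_dilate => //;
  [exact: measurable_funepos|exact: measurable_funeneg].
Qed.

(** By Tonelli, the integrals in [y] of the positive and negative parts of
    [g y * f (x - y)] are measurable in [x]. *)
Lemma measurable_convolution (R : realType) (f g : R -> R) :
  measurable_fun setT f -> measurable_fun setT g ->
  measurable_fun setT (convolution f g).
Proof.
move=> mf mg.
pose F (p : measurableTypeR R * measurableTypeR R) : \bar R :=
  (g p.2 * f (p.1 - p.2))%:E.
have msub : measurable_fun [set: measurableTypeR R * measurableTypeR R]
    (fun p => p.1 - p.2 : measurableTypeR R).
  exact: measurable_funB.
have mF : measurable_fun setT F.
  apply/measurable_EFinP; apply: measurable_funM; first exact: measurableT_comp.
  exact: (measurableT_comp mf msub).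
apply: measurableT_comp => //.
rewrite (_ : (fun x => _) = (fun x => \int[lebesgue_measure]_y F^\+ (x, y))
    \- (fun x => \int[lebesgue_measure]_y F^\- (x, y)))%E; last first.
  apply/funext=> x; rewrite [LHS]integralE.
  by rewrite (funepos_comp F (pair x)) (funeneg_comp F (pair x)).
apply: emeasurable_funB; apply: measurable_fun_fubini_tonelli_F => //.
  exact: measurable_funepos.
exact: measurable_funeneg.
Qed.

(** * Integrable functions and moments *)

Lemma inL1_moment (R : realType) (m : R) (K : R -> R) :
  measurable_fun setT K -> (beta m K < +oo)%E ->
  inL1 (fun t => `|t| `^ m * `|K t|).
Proof.
move=> mK K_fin; apply/integrableP; split.
  apply/measurable_EFinP; apply: measurable_funM; last exact: measurableT_comp.
  by apply: (measurableT_comp (measurable_powR m)); exact: normr_measurable.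
apply: le_lt_trans K_fin; rewrite le_eqVlt; apply/orP; left; apply/eqP.
apply: eq_integral => t _ /=.
by rewrite ger0_norm// mulr_ge0// powR_ge0.
Qed.

Lemma inL1_le (R : realType) (g G : R -> R) :
  measurable_fun setT g -> inL1 G -> (forall t, `|g t| <= G t) -> inL1 g.
Proof.
move=> mg intG gG; apply: (le_integrable measurableT _ _ intG).
  exact/measurable_EFinP.
by move=> t _; rewrite /= lee_fin (le_trans (gG t))// ler_norm.
Qed.

Lemma inL1D (R : realType) (g G : R -> R) :
  inL1 g -> inL1 G -> inL1 (fun t => g t + G t).
Proof.
by move=> intg intG; have := integrableD measurableT intg intG; apply.
Qed.

Lemma inL1Z (R : realType) (k : R) (g : R -> R) :
  inL1 g -> inL1 (fun t => k * g t).
Proof. by move=> intg; have := integrableZl measurableT k intg; apply. Qed.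

Lemma inL1_measurable (R : realType) (g : R -> R) :
  inL1 g -> measurable_fun setT g.
Proof. by move=> /measurable_int /measurable_EFinP. Qed.

Lemma moment_sum (R : realType) (K : R -> R) (d : nat -> R) (n : nat) :
  (forall j, (j < n)%N -> inL1 (fun t => t ^+ j * K t)) ->
  inL1 (fun t => \sum_(j < n) d j * (t ^+ j * K t)) /\
  (\int[lebesgue_measure]_t (\sum_(j < n) d j * (t ^+ j * K t)))%R =
  \sum_(j < n) d j * alpha j K.
Proof.
elim: n => [|n IH] Kmom.
  rewrite big_ord0; split.
    under eq_fun do rewrite big_ord0; exact: integrable0.
  under eq_Rintegral do rewrite big_ord0.
  by rewrite /Rintegral integral0.
have [intS intSE] := IH (fun j jn => Kmom j (ltnW jn)).
have intn := inL1Z (d n) (Kmom n (ltnSn n)).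
split.
  by under eq_fun do rewrite big_ord_recr/=; exact: inL1D.
under eq_Rintegral do rewrite big_ord_recr/=.
rewrite RintegralD// intSE big_ord_recr/= RintegralZl//.
exact: Kmom.
Qed.

Lemma powR_dilate_moment (R : realType) (s : nat) (m c t : R) :
  0 < m -> 0 < c ->
  `|- (c * t)| `^ m * `|- (c * t)| ^+ s =
  c `^ (s%:R + m) * `|t| `^ (s%:R + m).
Proof.
move=> m_gt0 c_gt0.
have ct_ge0 : 0 <= c * `|t| by rewrite mulr_ge0// ltW.
rewrite normrN normrM (gtr0_norm c_gt0) -powRM ?(ltW c_gt0)//.
rewrite powRD; last by rewrite gt_eqF// ltr_wpDl.
by rewrite powR_mulrn// mulrC.
Qed.

(** * The smoothing error at a point *)

(** Integrating the Taylor expansion of [f] at [x] against the dilated kernel.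
    The hypothesis on the oscillation of the last derivative is required for all
    shifts, because the kernel need not have compact support. *)
Lemma convolution_expansion (R : realType) (s : nat) (a delta A B c x : R)
    (f K : R -> R) :
  (1 <= s)%N -> 0 < a -> 0 < delta -> 0 < c -> 0 <= A -> 0 <= B ->
  measurable_fun setT f -> times_derivable s f -> kernel_of_order s K ->
  (beta (s%:R + a) K < +oo)%E -> (beta (s%:R + delta) K < +oo)%E ->
  (forall v, `|derive1n s f (x + v) - derive1n s f x| <=
             A * `|v| `^ a + B * `|v| `^ delta) ->
  `|convolution f (dilate c K) x - f x
     - derive1n s f x / s`!%:R * (- c) ^+ s * alpha s K| <=
  A * (c `^ (s%:R + a) * fine (beta (s%:R + a) K)) +
  B * (c `^ (s%:R + delta) * fine (beta (s%:R + delta) K)).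
Proof.
move=> s_ge1 a_gt0 delta_gt0 c_gt0 A_ge0 B_ge0 mf df.
move=> [[intK K1] Kmom K0 _] beta_a beta_d osc.
have mK := inL1_measurable intK.
have int_a := inL1_moment mK beta_a.
have int_d := inL1_moment mK beta_d.
rewrite convolution_dilate//.
pose d j := derive1n j f x / j`!%:R * (- c) ^+ j.
pose P t := \sum_(j < s.+1) d j * (t ^+ j * K t).
have PE t : P t = K t * (taylor_poly s f x).[- (c * t)].
  rewrite /P /taylor_poly horner_poly mulr_sumr; apply: eq_bigr => j _.
  by rewrite /d -mulNr exprMn; ring.
have [intP intPE] : inL1 P /\ (\int[lebesgue_measure]_t P t)%R =
    \sum_(j < s.+1) d j * alpha j K.
  by apply: moment_sum => j; rewrite ltnS; exact: Kmom.
pose E t := K t * (f (x - c * t) - (taylor_poly s f x).[- (c * t)]).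
pose G t := A * (c `^ (s%:R + a) * (`|t| `^ (s%:R + a) * `|K t|)) +
  B * (c `^ (s%:R + delta) * (`|t| `^ (s%:R + delta) * `|K t|)).
have EP t : K t * f (x - c * t) = P t + E t by rewrite PE /E; ring.
have EG t : `|E t| <= G t.
  have modulus_homo u : `|u| <= `|- (c * t)| ->
      `|derive1n s f (x + u) - derive1n s f x| <=
      A * `|- (c * t)| `^ a + B * `|- (c * t)| `^ delta.
    move=> u_le; apply: le_trans (osc u) _; apply: lerD; apply: ler_wpM2l => //.
      by apply: ge0_ler_powR => //; rewrite ?nnegrE// ltW.
    by apply: ge0_ler_powR => //; rewrite ?nnegrE// ltW.
  (* The expansion is used on the smallest centred interval
     that contains [- (c * t)]. *)
  have := taylor_oscillation df modulus_homo (lexx _).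
  move=> /(ler_wpM2l (normr_ge0 (K t))); rewrite -normrM => /le_trans; apply.
  rewrite mulrDl -!mulrA !powR_dilate_moment// /G le_eqVlt; apply/orP; left.
  by apply/eqP; ring.
have intG : inL1 G by apply: inL1D; do 2 apply: inL1Z.
(* The bound by [G] is also what makes the integrand of the convolution
   integrable: it is the sum of [P] and of [E]. *)
have mE : measurable_fun setT E.
  rewrite (_ : E = (fun t => K t * f (x - c * t) - P t)); last first.
    by apply/funext => t; rewrite EP addrC addKr.
  apply: measurable_funB; last exact: inL1_measurable.
  apply: measurable_funM => //; apply: measurableT_comp => //.
  by apply: measurable_funB => //; exact: mulrl_measurable.
have intE : inL1 E := inL1_le mE intG EG.
under eq_Rintegral do rewrite EP.
rewrite RintegralD// intPE.
have -> : \sum_(j < s.+1) d j * alpha j K =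
    f x + derive1n s f x / s`!%:R * (- c) ^+ s * alpha s K.
  rewrite big_ord_recr/=; congr (_ + _).
  rewrite -(prednK s_ge1) big_ord_recl big1 => [|j _]; last first.
    by rewrite K0 ?mulr0//= -[ltnRHS](prednK s_ge1) ltnS ltn_ord.
  rewrite /d /= fact0 divr1 expr0 mulr1 addr0.
  rewrite (_ : alpha 0 K = 1) ?mulr1// -K1.
  by apply: eq_Rintegral => t _; rewrite expr0 mul1r.
rewrite [X in `|X|](_ : _ = (\int[lebesgue_measure]_t E t)%R); last by ring.
apply: le_trans (le_normr_Rintegral measurableT intE) _.
apply: le_trans (le_Rintegral measurableT _ intG (fun t _ => EG t)) _.
  exact: integrable_norm.
rewrite RintegralD//; [|by do 2 apply: inL1Z..].
by rewrite !RintegralZl//; do ?apply: inL1Z.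
Qed.

(** * The Lipschitz class and the norm *)

(** Beyond the radius [r x] the trivial bound [2 * M] is absorbed in the power
    [delta] of [|v| / r x], which exceeds 1 there. *)
Lemma inLip_modulus (R : realType) (a delta : R) (g : R -> R) :
  0 < delta -> bounded_fun g -> inLip a delta g ->
  exists A B : R -> R,
    [/\ inL1 A, inL1 B, forall x, 0 <= A x /\ 0 <= B x &
      forall x v, `|g (x + v) - g x| <= A x * `|v| `^ a + B x * `|v| `^ delta].
Proof.
move=> delta_gt0 /pinfty_ex_gt0[M M_gt0 gM] [l [r [[ml mr] lr_gt0 osc lr_int]]].
have l_gt0 x : 0 < l x by case: (lr_gt0 x).
have r_gt0 x : 0 < r x by case: (lr_gt0 x).
have mrd : measurable_fun setT (fun x => r x `^ (- delta)).
  exact: (measurableT_comp (measurable_powR (- delta)) mr).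
have int_lr : inL1 (fun x => l x + r x `^ (- delta)).
  apply/integrableP; split; first exact/measurable_EFinP/measurable_funD.
  under eq_integral => x _ do
    rewrite /= ger0_norm ?addr_ge0 ?powR_ge0 ?(ltW (l_gt0 x))//.
  exact: lr_int.
exists l, (fun x => 2 * M * r x `^ (- delta)); split.
- apply: (inL1_le ml int_lr) => x.
  by rewrite gtr0_norm// lerDl powR_ge0.
- apply/inL1Z/(inL1_le mrd int_lr) => x.
  by rewrite ger0_norm ?powR_ge0// lerDr ltW.
- by move=> x; rewrite ltW// !mulr_ge0// ?powR_ge0// ltW.
- move=> x v; have [vr|rv] := leP `|v| (r x).
    rewrite -[v in x + v]opprK; apply: le_trans (osc x (- v) _) _.
      by rewrite normrN.
    by rewrite normrN lerDl !mulr_ge0// ?powR_ge0// ltW.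
  apply: (@le_trans _ _ (2 * M)).
    apply: le_trans (ler_normB _ _) _; rewrite mulr2n mulrDl mul1r.
    by apply: lerD; exact: gM.
  apply: ler_wpDl; first by rewrite mulr_ge0 ?powR_ge0// ltW.
  rewrite -[leRHS]mulrA ler_peMr//; first by rewrite mulr_ge0// ltW.
  rewrite powRN mulrC ler_pdivlMr ?powR_gt0// mul1r.
  by apply: ge0_ler_powR; rewrite ?nnegrE ?ltW// (lt_trans _ rv).
Qed.

Lemma normL1E (R : realType) (g : R -> R) :
  normL1 g = (\int[lebesgue_measure]_x `|g x|)%R.
Proof. by rewrite /normL1 Lnorm1. Qed.

Lemma fine_beta_le (R : realType) (m M : R) (K : R -> R) :
  (beta m K <= M%:E)%E -> (beta m K < +oo)%E /\ 0 <= fine (beta m K) <= M.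
Proof.
move=> KM; have K_lty : (beta m K < +oo)%E by rewrite (le_lt_trans KM) ?ltry.
have K_ge0 : (0 <= beta m K)%E.
  by apply: integral_ge0 => t _; rewrite lee_fin mulr_ge0// powR_ge0.
by rewrite fine_ge0//= -lee_fin fineK// ge0_fin_numE.
Qed.

(** * The rate of convergence *)

Theorem theorem3 (R : realType) (s : nat) (a delta : R) (h : nat -> R)
    (f : R -> R) (K : nat -> R -> R)
    (s_ge1 : (1 <= s)%N)
    (a_gt0 : 0 < a) (a_le1 : a <= 1)
    (delta_gt1 : 1 < delta)
    (h_gt0 : forall n, 0 < h n)
    (h_cvg0 : h @ \oo --> 0)
    (f_density : is_density f)
    (f_derivable : times_derivable s f)
    (fs_L1 : inL1 (derive1n s f))
    (fs_C : inC (derive1n s f))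
    (fs_Lip : inLip a delta (derive1n s f))
    (K_order : forall n, kernel_of_order s (K n))
    (K_alpha : (fun n => alpha s (K n)) =O_\oo (fun n => h n `^ a))
    (K_beta : (ereal_sup (range (fun n =>
         maxe (beta (s%:R + a) (K n)) (beta (s%:R + delta) (K n)))) < +oo)%E) :
  (forall n, inL1 (fun x => convolution f (dilate (h n) (K n)) x - f x)) /\
  (fun n => normL1 (fun x => convolution f (dilate (h n) (K n)) x - f x))
    =O_\oo (fun n => h n `^ (s%:R + a)).
Proof.
have delta_gt0 : 0 < delta by rewrite (lt_trans _ delta_gt1).
have [mf _ _] := f_density; have [_ fs_bounded] := fs_C.
have [A [B [intA intB AB_ge0 osc]]] :=
  inLip_modulus delta_gt0 fs_bounded fs_Lip.
have [b betaP] : exists b, forall n, (beta (s%:R + a) (K n) <= b%:E)%E /\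
    (beta (s%:R + delta) (K n) <= b%:E)%E.
  set S := ereal_sup _ in K_beta.
  have beta_leS n : (beta (s%:R + a) (K n) <= S)%E /\
      (beta (s%:R + delta) (K n) <= S)%E.
    apply/andP; rewrite -ge_max; apply: ereal_sup_ubound; by exists n.
  exists (fine S) => n; rewrite fineK; first exact: beta_leS.
  rewrite ge0_fin_numE//; apply: le_trans (beta_leS 0%N).1.
  by apply: integral_ge0 => t _; rewrite lee_fin mulr_ge0// powR_ge0.
have beta_a n := fine_beta_le (betaP n).1.
have beta_d n := fine_beta_le (betaP n).2.
pose g n x := convolution f (dilate (h n) (K n)) x - f x.
pose W n x := h n ^+ s * `|alpha s (K n)| * `|derive1n s f x| +
  (h n `^ (s%:R + a) * b * A x + h n `^ (s%:R + delta) * b * B x).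
have gW n x : `|g n x| <= W n x.
  have [A_ge0 B_ge0] := AB_ge0 x.
  have := convolution_expansion s_ge1 a_gt0 delta_gt0 (h_gt0 n) A_ge0 B_ge0
    mf f_derivable (K_order n) (beta_a n).1 (beta_d n).1 (osc x).
  rewrite -/(g n x); set p := _ * alpha s (K n) => gp.
  rewrite -[g n x](subrK p) addrC; apply: le_trans (ler_normD _ _) _.
  apply: lerD.
    rewrite /p !normrM normfV normrX normrN (gtr0_norm (h_gt0 n)).
    rewrite -[leLHS]mulrA [leLHS]mulrC ler_wpM2l//.
      by rewrite mulr_ge0// exprn_ge0// ltW.
    rewrite normr_nat ler_pdivrMr ?ltr0n ?fact_gt0// ler_peMr// ler1n.
    exact: fact_gt0.
  apply: le_trans gp _; apply: lerD.
    rewrite mulrC ler_wpM2r// ler_wpM2l ?powR_ge0//.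
    by case/andP: (beta_a n).2.
  rewrite mulrC ler_wpM2r// ler_wpM2l ?powR_ge0//.
  by case/andP: (beta_d n).2.
have int_fs : inL1 (fun x => `|derive1n s f x|) by exact: integrable_norm.
have intW n : inL1 (W n) by apply: inL1D; [|apply: inL1D]; exact: inL1Z.
have int_g n : inL1 (g n).
  apply: inL1_le (intW n) (gW n); apply: measurable_funB => //.
  apply: measurable_convolution => //; have [[intK _] _ _ _] := K_order n.
  apply: measurable_funM => //; apply: measurableT_comp (inL1_measurable intK) _.
  exact: mulrr_measurable.
split=> //.
pose I1 := (\int[lebesgue_measure]_x `|derive1n s f x|)%R.
pose I2 := (\int[lebesgue_measure]_x A x)%R.
pose I3 := (\int[lebesgue_measure]_x B x)%R.
have I1_ge0 : 0 <= I1 by apply: Rintegral_ge0.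
have I2_ge0 : 0 <= I2 by apply: Rintegral_ge0 => x _; case: (AB_ge0 x).
have I3_ge0 : 0 <= I3 by apply: Rintegral_ge0 => x _; case: (AB_ge0 x).
have norm_g n : `|normL1 (g n)| <= h n ^+ s * `|alpha s (K n)| * I1 +
    (h n `^ (s%:R + a) * b * I2 + h n `^ (s%:R + delta) * b * I3).
  rewrite normL1E ger0_norm; last exact: Rintegral_ge0.
  apply: le_trans (le_Rintegral measurableT _ (intW n) (fun x _ => gW n x)) _.
    exact: integrable_norm (int_g n).
  rewrite RintegralD//; [|exact: inL1Z|by apply: inL1D; exact: inL1Z].
  by rewrite RintegralD// ?RintegralZl//; exact: inL1Z.
have b_ge0 : 0 <= b.
  by have [_ /andP[+ ?]] := beta_a 0%N; move=> /le_trans; apply.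
have /eqO_exP[k k_gt0 alpha_le] := K_alpha.
(* The final 1 only serves to make the constant positive. *)
apply/eqO_exP; exists (k * I1 + (b * I2 + b * I3) + 1).
  by rewrite ltr_wpDl// !addr_ge0// mulr_ge0// ltW.
near=> n.
apply: le_trans (norm_g n) _.
have h_le1 : h n <= 1 by near: n; apply: (cvgr_le _ h_cvg0).
have alpha_n : `|alpha s (K n)| <= k * h n `^ a.
  by rewrite -[h n `^ a]ger0_norm ?powR_ge0//; near: n.
have pow_ge0 := powR_ge0 (h n) (s%:R + a).
rewrite (ger0_norm pow_ge0) 2!mulrDl mulrDl.
apply: ler_wpDr; first by rewrite mul1r.
apply: lerD; [|apply: lerD].
- rewrite [leRHS]mulrAC ler_wpM2r//.
  rewrite powRD ?gt_eqF ?ltr_wpDl// powR_mulrn ?(ltW (h_gt0 n))//.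
  by rewrite mulrCA ler_wpM2l ?exprn_ge0// ltW.
- by rewrite -mulrA mulrC.
- rewrite -mulrA mulrC ler_wpM2l ?mulr_ge0//.
  apply: ger_powR; first by rewrite h_gt0.
  by rewrite lerD2l (le_trans a_le1)// ltW.
Unshelve. all: by end_near.
Qed.
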